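(* Let $p$ be an odd prime. Let $m,h$ be two positive integers with $m\mid h$ and let $q=p^h$. Let $n=wp^{mz}$, where $w,z$ are integers with $1\leq w\leq p^m$ and $1\leq z\leq \frac{h}{m}-1$. Suppose that $t$ is a positive integer such that $2^t\mid\frac{h}{m}$ and $2^t=p^e+1$ for some integer $0\leq e\leq h-1$. Then the following hold. 1) For every integer $k$ with $1\leq k\leq\left\lfloor\frac{p^e+n-1}{p^e+1}\right\rfloor$ and every integer $l$ with $0\leq l\leq k$, there exists an $[n,k]_q$ MDS code $\mathcal{C}$ with $\dim(\mathrm{Hull}_e(\mathcal{C}))=l$. 2) For every integer $k$ with $1\leq k\leq\left\lfloor\frac{p^e+n-1}{p^e+1}\right\rfloor$ and every integer $l$ with $0\leq l\leq k-1$, there exists an $[n+1,k]_q$ MDS code $\mathcal{C}$ with $\dim(\mathrm{Hull}_e(\mathcal{C}))=l$.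
   Context: For $q=p^h$ and an integer $0\leq e\leq h-1$, the $e$-Galois inner product of $\mathbf{c}_1=(c_{11},\dots,c_{1N})$ and $\mathbf{c}_2=(c_{21},\dots,c_{2N})$ in $\mathbb{F}_q^N$ is $(\mathbf{c}_1,\mathbf{c}_2)_e=\sum_{i=1}^N c_{1i}c_{2i}^{p^e}$. For a linear code $\mathcal{C}\subseteq\mathbb{F}_q^N$, its $e$-Galois dual is $\mathcal{C}^{\bot_e}=\{\mathbf{c}_1\in\mathbb{F}_q^N:(\mathbf{c}_1,\mathbf{c}_2)_e=0\text{ for all }\mathbf{c}_2\in\mathcal{C}\}$, and its $e$-Galois hull is $\mathrm{Hull}_e(\mathcal{C})=\mathcal{C}\cap\mathcal{C}^{\bot_e}$. An $[N,k]_q$ code is a $k$-dimensional linear subspace of $\mathbb{F}_q^N$; it is MDS if its minimum Hamming distance is $N-k+1$. *)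

(* Defs.v *)
From HB Require Import structures.
From mathcomp Require Import all_boot all_order all_algebra.

Set Implicit Arguments.
Unset Strict Implicit.
Unset Printing Implicit Defensive.

Import GRing.Theory.
Local Open Scope ring_scope.

Section Codes.

Variables (F : finFieldType) (N : nat).
Implicit Types (c : 'rV[F]_N) (C : {vspace 'rV[F]_N}).

Definition hamming_dist c1 c2 : nat := #|[set i | c1 0 i != c2 0 i]|.

(* A relation rather than a function: a code with fewer than two words has no
   minimum distance. *)
Definition has_min_dist C (d : nat) : Prop :=
  (exists c1 c2, [/\ c1 \in C, c2 \in C, c1 != c2 & hamming_dist c1 c2 = d]) /\
  (forall c1 c2, c1 \in C -> c2 \in C -> c1 != c2 ->
     (d <= hamming_dist c1 c2)%N).

(* The subtraction does not truncate, since the dimension of [C] is at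
   most [N]. *)
Definition MDS C : Prop := has_min_dist C (N - \dim C + 1)%N.

Definition galois_inner (p e : nat) c1 c2 : F :=
  \sum_(i < N) c1 0 i * c2 0 i ^+ (p ^ e).

(* The inner product is linear in its left argument only, so the map below
   takes the right argument first. *)
Definition galois_innerr (p e : nat) c2 c1 : F^o := galois_inner p e c1 c2.

Fact galois_innerr_is_linear p e c2 : linear (galois_innerr p e c2).
Proof.
move=> a u v; rewrite /galois_innerr /galois_inner scaler_sumr -big_split /=.
by apply: eq_bigr => i _; rewrite !mxE mulrDl -mulrA.
Qed.

HB.instance Definition _ p e c2 :=
  GRing.isLinear.Build F 'rV[F]_N F^o _ (galois_innerr p e c2)
    (galois_innerr_is_linear p e c2).

(* Defined as an intersection of kernels so that it is a subspace by
   construction; [galois_dualP] gives the pointwise description. *)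
Definition galois_dual (p e : nat) C : {vspace 'rV[F]_N} :=
  (\bigcap_(c2 in C) lker (linfun (galois_innerr p e c2)))%VS.

Lemma galois_dualP p e C c1 :
  reflect (forall c2, c2 \in C -> galois_inner p e c1 c2 = 0)
          (c1 \in galois_dual p e C).
Proof.
apply: (iffP subv_bigcapP) => H c2 c2C.
  by move: (H c2 c2C); rewrite -memvE memv_ker lfunE /= => /eqP.
by rewrite -memvE memv_ker lfunE /=; apply/eqP/H.
Qed.

Definition galois_hull (p e : nat) C : {vspace 'rV[F]_N} :=
  (C :&: galois_dual p e C)%VS.

End Codes.

(* Main.v *)
(* Let [K] be the subfield of order [p ^ m] and let the evaluation points be
   [w] cosets [H + c * b], with [c] in [K], of a [K]-subspace [H] of
   dimension [z]. The product of the differences from one point to all others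
   is then a constant times an element of [K^*]; since [2 ^ t] divides [h /
   m], it divides [(q - 1) / (p ^ m - 1)], so elements of [K^*] are [(p ^ e +
   1)]-th powers in [F]. Hence suitable column multipliers turn the form [(f,
   g) |-> sum_a f(a) g(a) ^ (p ^ e) / prod_(b != a) (a - b)], which vanishes
   in the given range of degrees, into the [e]-Galois inner product of a
   generalized Reed-Solomon code, which is therefore self-orthogonal. Adding
   the point at infinity leaves a single nonzero term. Rescaling [r]
   coordinates by an element whose [(p ^ e + 1)]-th power is not 1 makes the
   form nondegenerate on exactly these coordinates, and by the MDS property
   the codewords vanishing there form a subspace of codimension [r], which is
   the hull. *)
Require Import Defs.
From HB Require Import structures.
From mathcomp Require Import all_boot all_order all_algebra.
From mathcomp Require Import cyclic all_field zify ring.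

Set Implicit Arguments.
Unset Strict Implicit.
Unset Printing Implicit Defensive.

Import GRing.Theory.
Local Open Scope ring_scope.

Lemma exists_subset (T : finType) (S : {set T}) (d : nat) :
  (d <= #|S|)%N -> exists2 S' : {set T}, S' \subset S & #|S'| = d.
Proof.
rewrite -bin_gt0 -cards_draws => /card_gt0P[S'].
by rewrite inE => /andP[sS /eqP]; exists S'.
Qed.

(** * MDS codes through zeros of codewords, and hulls after rescaling coordinates *)

Section MDSHull.

Variables (F : finFieldType) (N : nat).
Implicit Types (x y : 'rV[F]_N) (C U : {vspace 'rV[F]_N}) (S : {set 'I_N}).

Definition zeros x : {set 'I_N} := [set i | x 0 i == 0].

(** By linearity, the bound on zeros puts distinct codewords at distance at least [N - k + 1]; for
    [0 < k] a dimension count shows that this is attained. *)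
Definition mds_of_dim (k : nat) C : Prop :=
  \dim C = k /\ (forall x, x \in C -> x != 0 -> (#|zeros x| < k)%N).

Definition vanishing S : {vspace 'rV[F]_N} :=
  (\bigcap_(i in S) lker (linfun (col i : 'rV[F]_N -> 'cV[F]_1)))%VS.

Lemma vanishingP S x :
  reflect (forall i, i \in S -> x 0 i = 0) (x \in vanishing S).
Proof.
have colE i : (col i x == 0) = (x 0 i == 0).
  apply/eqP/eqP => [/colP/(_ 0)|xi0]; first by rewrite !mxE.
  by apply/colP => j; rewrite !mxE ord1.
apply: (iffP subv_bigcapP) => xS i iS; have := xS i iS.
  by rewrite -memvE memv_ker lfunE /= colE => /eqP.
by rewrite -memvE memv_ker lfunE /= colE => ->.
Qed.

Lemma dim_vanishing1 U i : (\dim U <= (\dim (U :&: vanishing [set i])).+1)%N.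
Proof.
rewrite /vanishing big_set1.
rewrite -(limg_ker_dim (linfun (col i : 'rV[F]_N -> 'cV[F]_1)) U).
rewrite -[leqRHS]addn1 leq_add2l.
by rewrite (leq_trans (dimvS (subvf _))) // dimvf /dim /=.
Qed.

Lemma vanishingU S1 S2 :
  vanishing (S1 :|: S2) = (vanishing S1 :&: vanishing S2)%VS.
Proof.
apply/vspaceP => x; rewrite memv_cap.
apply/vanishingP/andP => [x0|[/vanishingP x1 /vanishingP x2] i].
  by split; apply/vanishingP => i iS; apply: x0; rewrite inE iS ?orbT.
by rewrite inE => /orP[/x1|/x2].
Qed.

Lemma dim_vanishing U S : (\dim U <= \dim (U :&: vanishing S) + #|S|)%N.
Proof.
have [n] := ubnP #|S|; elim: n => // n IHn in S U *.
have [->|[i iS]] := set_0Vmem S.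
  by move=> _; rewrite /vanishing big_set0 capvf cards0 addn0.
rewrite -(setD1K iS) cardsU1 !inE eqxx /= ltnS add1n => leSn.
rewrite vanishingU capvA addnS (leq_trans (dim_vanishing1 U i)) // ltnS.
exact: IHn.
Qed.

Section MDSCode.

Variables (k : nat) (C : {vspace 'rV[F]_N}).
Hypothesis (C_mds : mds_of_dim k C).

Lemma mds_of_dim_leq : (k <= N)%N.
Proof.
rewrite -C_mds.1 (leq_trans (dimvS (subvf _))) //.
by rewrite dimvf /dim /= mul1n.
Qed.

(** Counting linear conditions gives one inequality. For the other, enlarge [S] by [T] to [k]
    coordinates: only the zero word vanishes on all of them, and [T] costs at most [k - #|S|]
    dimensions. *)
Lemma dim_mds_vanishing S :
  (#|S| <= k)%N -> \dim (C :&: vanishing S) = (k - #|S|)%N.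
Proof.
move=> leSk; apply/eqP; rewrite eqn_leq leq_subLR addnC.
rewrite -[X in _ && (X <= _)%N]C_mds.1 dim_vanishing andbT.
have: (k - #|S| <= #|~: S|)%N.
  by rewrite leq_subLR cardsC card_ord mds_of_dim_leq.
case/exists_subset => T sTS cardT.
rewrite (leq_trans (dim_vanishing _ T)) // cardT -capvA -vanishingU.
have cardST : #|S :|: T| = k.
  by rewrite cardsU disjoint_setI0 ?cards0 ?cardT ?subn0 ?subnKC //
     disjoint_sym disjoints_subset.
suff ->: (C :&: vanishing (S :|: T) = 0)%VS by rewrite dimv0.
apply/eqP; rewrite -subv0; apply/subvP => x; rewrite memv_cap memv0.
case/andP => xC /vanishingP xS; apply: contraLR (leqnn k) => x_neq0.
rewrite -ltnNge -{1}cardST (leq_ltn_trans _ (C_mds.2 x xC x_neq0)) //.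
by apply/subset_leq_card/subsetP => i iST; rewrite inE xS.
Qed.

(** Dropping [i] from [S] raises the dimension of the vanishing subcode by one. *)
Lemma mds_separates S i : (#|S| <= k)%N -> i \in S ->
  exists2 x, x \in C & x 0 i != 0 /\ forall j, j \in S -> j != i -> x 0 j = 0.
Proof.
move=> leSk iS; have cardS := cardsD1 i S; rewrite iS in cardS.
have: ~~ (C :&: vanishing (S :\ i) <= vanishing S)%VS.
  apply/negP => sub.
  have: (\dim (C :&: vanishing (S :\ i)) <= \dim (C :&: vanishing S))%N.
    by apply: dimvS; rewrite subv_cap capvSl.
  by rewrite !dim_mds_vanishing //; lia.
case/subvPn => x; rewrite memv_cap => /andP[xC /vanishingP xS].
move=> /vanishingP xNS; exists x => //; split.
  apply/eqP => xi0; apply: xNS => j jS; have [->//|ji] := eqVneq j i.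
  by apply: xS; rewrite !inE ji.
by move=> j jS ji; apply: xS; rewrite !inE ji.
Qed.

Lemma mds_of_dim_MDS : (0 < k)%N -> MDS C.
Proof.
move=> k_gt0; have leN := mds_of_dim_leq.
have distE c1 c2 : hamming_dist c1 c2 = (N - #|zeros (c1 - c2)|)%N.
  rewrite -[X in (X - _)%N]card_ord -(cardsC (zeros (c1 - c2))) addKn.
  by apply: eq_card => i; rewrite !inE !mxE subr_eq0.
have bound c1 c2 : c1 \in C -> c2 \in C -> c1 != c2 ->
    (N - k + 1 <= hamming_dist c1 c2)%N.
  move=> c1C c2C c12; rewrite distE.
  have := C_mds.2 _ (rpredB c1C c2C); rewrite subr_eq0 => /(_ c12) lt_k.
  by rewrite addn1 ltn_sub2l // (leq_trans lt_k).
rewrite /MDS C_mds.1; split=> //.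
(* A nonzero word vanishing on [k - 1] coordinates attains the bound. *)
have: (k.-1 <= #|[set: 'I_N]|)%N.
  by rewrite cardsT card_ord (leq_trans (leq_pred k)).
case/exists_subset => S _ cardS.
have: (C :&: vanishing S)%VS != 0%VS.
  rewrite -dimv_eq0 dim_mds_vanishing ?cardS ?leq_pred //.
  by rewrite subn_eq0 -ltnNge prednK.
rewrite -vpick0; set x := vpick _ => x_neq0.
have := memv_pick (C :&: vanishing S); rewrite memv_cap.
case/andP=> xC /vanishingP xS.
exists x, 0; split; rewrite ?mem0v //.
apply/eqP; rewrite eqn_leq bound ?mem0v // andbT.
have: S \subset zeros x by apply/subsetP => i iS; rewrite inE xS.
by move/subset_leq_card; rewrite distE subr0 cardS; lia.
Qed.

End MDSCode.

(** [S] holds the coordinates where the form already lives: none for a self-orthogonal code, the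
    point at infinity for the extended one. Scaling [s - #|S|] others by [alpha] adds terms with
    factor [alpha ^+ (p ^ e + 1) - 1], so the form becomes diagonal with nonzero coefficients on [s]
    coordinates. *)
Lemma scaled_mds_hull (p e k s : nat) C S (alpha : F) :
    (0 < p)%N -> (0 < k)%N -> mds_of_dim k C ->
    (forall x y, x \in C -> y \in C ->
       galois_inner p e x y = \sum_(i in S) x 0 i * y 0 i ^+ (p ^ e)) ->
    alpha != 0 -> alpha ^+ (p ^ e + 1) != 1 -> (#|S| <= s <= k)%N ->
  exists C' : {vspace 'rV[F]_N},
    [/\ \dim C' = k, MDS C' & \dim (galois_hull p e C') = (k - s)%N].
Proof.
move=> p_gt0 k_gt0 C_mds innerC alpha0 alpha1 /andP[leSs lesk].
have leN := mds_of_dim_leq C_mds.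
have Q_gt0 : (0 < p ^ e)%N by rewrite expn_gt0 p_gt0.
have: (s - #|S| <= #|~: S|)%N by have := cardsC S; rewrite card_ord; lia.
case/exists_subset => T sTS cardT.
have TS i : i \in T -> i \notin S by move/(subsetP sTS); rewrite inE.
have cardST : #|S :|: T| = s.
  by rewrite cardsU disjoint_setI0 ?cards0 ?cardT ?subn0 ?subnKC //
     disjoint_sym disjoints_subset.
pose d i := if i \in T then alpha else 1.
pose f := linfun (mulmxr (diag_mx (\row_i d i)) : 'rV[F]_N -> 'rV[F]_N).
have d_neq0 i : d i != 0 by rewrite /d; case: ifP; rewrite ?oner_eq0.
have fE x i : f x 0 i = x 0 i * d i.
  by rewrite lfunE /= mul_mx_diag !mxE.
have zerosf x : zeros (f x) = zeros x.
  by apply/setP => i; rewrite !inE fE mulf_eq0 (negPf (d_neq0 i)) orbF.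
have f_inj x : f x = 0 -> x = 0.
  move=> fx0; apply/rowP => i; apply/eqP.
  have: i \in zeros (f x) by rewrite inE fx0 mxE.
  by rewrite zerosf inE !mxE.
have kerf U : (U :&: lker f = 0)%VS.
  apply/eqP; rewrite -subv0; apply/subvP => x.
  by rewrite memv_cap memv0 memv_ker => /andP[_ /eqP/f_inj ->].
have fC_mds : mds_of_dim k (f @: C).
  split; first by rewrite limg_dim_eq // C_mds.1.
  move=> _ /memv_imgP[x xC ->] fx0; rewrite zerosf C_mds.2 //.
  by apply: contraNneq fx0 => ->; rewrite linear0.
pose b i := if i \in T then alpha ^+ (p ^ e + 1) - 1 else 1.
have b_neq0 i : b i != 0 by rewrite /b; case: ifP; rewrite ?oner_eq0 ?subr_eq0.
have innerf x y : x \in C -> y \in C -> galois_inner p e (f x) (f y) =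
    \sum_(i in S :|: T) b i * (x 0 i * y 0 i ^+ (p ^ e)).
  move=> xC yC.
  (* Adding and subtracting the unscaled product, known to be the sum over [S], leaves only the
     change on [T]. *)
  rewrite big_mkcond -[LHS]addr0 -[in LHS](subrr (galois_inner p e x y)).
  rewrite addrCA {1}innerC // [in X in X + _ = _]big_mkcond.
  rewrite /galois_inner -sumrB.
  rewrite -big_split; apply: eq_bigr => i _ /=; rewrite !fE exprMn inE /b /d.
  have [/TS/negPf->|_] := boolP (i \in T).
    rewrite orbT add0r mulrBl mul1r; congr (_ - _).
    by rewrite addn1 exprS; ring.
  by rewrite orbF expr1n !mulr1 subrr addr0 mul1r.
exists (f @: C)%VS.
split; [exact: fC_mds.1 | exact: mds_of_dim_MDS fC_mds k_gt0 |].
suff ->: galois_hull p e (f @: C)%VS = (f @: (C :&: vanishing (S :|: T)))%VS.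
  by rewrite limg_dim_eq // (dim_mds_vanishing C_mds) cardST.
apply/vspaceP => fx; rewrite memv_cap.
apply/andP/memv_imgP => [[/memv_imgP[x xC ->] /galois_dualP dual_fx]|].
  exists x => //; rewrite memv_cap xC; apply/vanishingP => i iST.
  have leSTk : (#|S :|: T| <= k)%N by rewrite cardST.
  (* Pairing with a word that is nonzero only at [i] within [S :|: T] isolates [x 0 i]. *)
  have [y yC [yi0 yj0]] := mds_separates C_mds leSTk iST.
  have := dual_fx (f y) (memv_img f yC).
  rewrite innerf // (bigD1 i) //= big1 => [|j /andP[jST ji]]; last first.
    by rewrite yj0 // expr0n (gtn_eqF Q_gt0) !mulr0.
  move/eqP; rewrite addr0 !mulf_eq0 (negPf (b_neq0 i)) /= expf_eq0 (negPf yi0).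
  by rewrite andbF orbF => /eqP.
case=> x; rewrite memv_cap => /andP[xC /vanishingP x0] ->.
split; first exact: memv_img.
apply/galois_dualP => _ /memv_imgP[y yC ->]; rewrite innerf // big1 // => i iST.
by rewrite x0 // mul0r mulr0.
Qed.

(** The bound on zeros also forces injectivity, since the zero word has [N >= k] zeros. *)
Lemma mds_of_dim_limg (k : nat) (f : 'Hom('rV[F]_k, 'rV[F]_N)) :
    (k <= N)%N -> (forall u, u != 0 -> (#|zeros (f u)| < k)%N) ->
  mds_of_dim k (limg f).
Proof.
move=> leN zerosf; split.
  rewrite limg_dim_eq ?dimvf /dim /= ?mul1n //.
  apply/eqP; rewrite -subv0; apply/subvP => u.
  rewrite memv_cap memv0 memv_ker => /andP[_ /eqP fu0].
  apply: contraLR leN => /zerosf; rewrite fu0 -ltnNge => /(leq_trans _); apply.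
  rewrite ltnS (_ : zeros 0 = setT) ?cardsT ?card_ord //.
  by apply/setP => i; rewrite !inE mxE eqxx.
move=> _ /memv_imgP[u _ ->] fu0; apply: zerosf.
by apply: contraNneq fu0 => ->; rewrite linear0.
Qed.

End MDSHull.

(** * Lagrange interpolation on a finite set of nodes *)

Section Lagrange.

Variables (F : finFieldType) (A : {set F}).

(** For [a] in [A], this is the derivative at [a] of the monic polynomial with simple roots [A]. *)
Definition node_prod (a : F) : F := \prod_(b in A :\ a) (a - b).

Lemma node_prod_neq0 a : node_prod a != 0.
Proof.
by apply/prodf_neq0 => b; rewrite !inE subr_eq0 eq_sym => /andP[].
Qed.

(* The sum is the coefficient of degree [#|A| - 1] of the polynomial
   interpolating [P] on [A], which is [P] itself. *)
Lemma sum_divided_nodes (P : {poly F}) : (size P < #|A|)%N ->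
  \sum_(a in A) P.[a] / node_prod a = 0.
Proof.
move=> ltPA; pose L a := \prod_(b in A :\ a) ('X - b%:P).
have sizeL a : a \in A -> size (L a) = #|A|.
  move=> aA; rewrite /L -big_enum size_prod_XsubC -cardE.
  by rewrite (cardsD1 a A) aA.
have L_eval a b : b \in A -> b != a -> (L a).[b] = 0.
  move=> bA ba; rewrite /L horner_prod (bigD1 b) ?inE ?ba //=.
  by rewrite !hornerE subrr mul0r.
have L_node a : (L a).[a] = node_prod a.
  by rewrite /L horner_prod; apply: eq_bigr => b _; rewrite !hornerE.
pose R := \sum_(a in A) (P.[a] / node_prod a) *: L a.
have RE : P = R.
  apply/eqP; rewrite -subr_eq0; apply/eqP.
  apply: (@roots_geq_poly_eq0 _ _ (enum A)); rewrite ?enum_uniq //.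
    apply/allP => b; rewrite mem_enum => bA; rewrite rootE !hornerE horner_sum.
    rewrite (bigD1 b) //= big1 => [|a /andP[aA ab]].
      by rewrite hornerZ L_node divfK ?node_prod_neq0 // addr0 subrr.
    by rewrite hornerZ L_eval ?mulr0 // eq_sym.
  rewrite -cardE (leq_trans (size_polyD _ _)) // geq_max ltnW //= size_polyN.
  apply: (leq_trans (size_sum _ _ _)); apply/bigmax_leqP => a aA.
  by rewrite (leq_trans (size_scale_leq _ _)) ?sizeL.
have /(congr1 (fun T : {poly F} => T`_#|A|.-1)) := RE.
rewrite nth_default; last by rewrite -ltnS (ltn_predK ltPA).
move=> coef0; rewrite [RHS]coef0 coef_sum; apply: eq_bigr => a aA.
rewrite coefZ -(sizeL a aA) -lead_coefE.
by rewrite (monicP (monic_prod_XsubC _ _ _)) mulr1.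
Qed.

End Lagrange.

(** * Generalized Reed-Solomon codes and their extension at infinity *)

Section ReedSolomon.

Variables (F : finFieldType) (A : {set F}) (v : F -> F) (gamma : F).
Variables (p e k : nat).
Implicit Types (u : 'rV[F]_k).

Definition grs_word u : 'rV[F]_#|A| :=
  \row_i (v (enum_val i) * (rVpoly u).[enum_val i]).

(** The coefficient of degree [k - 1] plays the role of the value at infinity. *)
Definition extended_grs_word u : 'rV[F]_(#|A| + 1) :=
  row_mx (grs_word u) (const_mx (rVpoly u)`_k.-1).

Fact grs_word_is_linear : linear grs_word.
Proof.
move=> c u1 u2; apply/rowP => i; rewrite !mxE linearP hornerD hornerZ.
by rewrite mulrDr mulrCA.
Qed.

HB.instance Definition _ :=
  GRing.isLinear.Build F 'rV[F]_k 'rV[F]_#|A| _ grs_word grs_word_is_linear.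

Fact extended_grs_word_is_linear : linear extended_grs_word.
Proof.
move=> c u1 u2; rewrite /extended_grs_word !linearP coefD coefZ.
by rewrite scale_row_mx add_row_mx; congr row_mx; apply/rowP => i; rewrite !mxE.
Qed.

HB.instance Definition _ :=
  GRing.isLinear.Build F 'rV[F]_k 'rV[F]_(#|A| + 1) _
    extended_grs_word extended_grs_word_is_linear.

Hypotheses (p_gt0 : (0 < p)%N) (k_gt0 : (0 < k)%N).
Hypothesis v_neq0 : forall a, a \in A -> v a != 0.
Hypothesis v_norm :
  forall a, a \in A -> v a ^+ (p ^ e + 1) = gamma / node_prod A a.
Hypothesis k_bound : (k.-1 * (p ^ e + 1) + 2 <= #|A|)%N.

(** Zeros of the word are distinct roots. The bound uses the actual size instead of [k] because the
    extended code gains from a smaller degree. *)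
Lemma card_zeros_grs_word u :
  u != 0 -> (#|zeros (grs_word u)| < size (rVpoly u))%N.
Proof.
move=> u_neq0; rewrite cardE -(size_map (fun i => enum_val i)).
apply: max_poly_roots.
- by apply: contraNneq u_neq0 => u0; rewrite -(rVpolyK u) u0 linear0.
- apply/allP => _ /mapP[i i_zero ->]; move: i_zero.
  by rewrite mem_enum inE mxE mulf_eq0 (negPf (v_neq0 (enum_valP i))).
- by rewrite map_inj_uniq ?enum_uniq //; exact: enum_val_inj.
Qed.

(** By [v_norm] the product is [gamma] times the divided sum of [P], whose degree is at most
    [(k - 1) * (p ^ e + 1)], hence at most [#|A| - 2] by [k_bound]. *)
Lemma grs_word_self_orthogonal u1 u2 :
  galois_inner p e (grs_word u1) (grs_word u2) = 0.
Proof.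
have Q_gt0 : (0 < p ^ e)%N by rewrite expn_gt0 p_gt0.
pose P := rVpoly u1 * rVpoly u2 ^+ (p ^ e).
have sizeP : (size P < #|A|)%N.
  have s1 : (size (rVpoly u1) <= k)%N by exact: size_poly.
  have s2 : (size (rVpoly u2) <= k)%N by exact: size_poly.
  have := size_polyMleq (rVpoly u1) (rVpoly u2 ^+ (p ^ e)).
  have := size_poly_exp_leq (rVpoly u2) (p ^ e).
  have: ((size (rVpoly u2)).-1 * p ^ e <= k.-1 * p ^ e)%N.
    by rewrite leq_mul2r; lia.
  by rewrite -/P; nia.
transitivity (gamma * \sum_(a in A) P.[a] / node_prod A a); last first.
  by rewrite sum_divided_nodes ?mulr0.
rewrite mulr_sumr big_enum_val; apply: eq_bigr => i _.
rewrite !mxE hornerM horner_exp exprMn.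
transitivity (v (enum_val i) ^+ (p ^ e + 1) *
  ((rVpoly u1).[enum_val i] * (rVpoly u2).[enum_val i] ^+ (p ^ e))).
  by rewrite addn1 exprS; ring.
by rewrite v_norm ?enum_valP //; ring.
Qed.

Lemma grs_mds : mds_of_dim k (limg (linfun grs_word)).
Proof.
apply: mds_of_dim_limg => [|u u_neq0]; first nia.
rewrite lfunE; apply: leq_trans (card_zeros_grs_word u_neq0) _.
exact: size_poly.
Qed.

(** A zero at infinity means degree below [k - 1], hence one fewer possible zero among the finite
    points. *)
Lemma extended_grs_mds : mds_of_dim k (limg (linfun extended_grs_word)).
Proof.
apply: mds_of_dim_limg => [|u u_neq0]; first nia.
rewrite lfunE /=; set c := (rVpoly u)`_k.-1.
have ->: #|zeros (extended_grs_word u)| =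
    (#|zeros (grs_word u)| + (c == 0%R))%N.
  rewrite -[LHS]sum1_card -[X in _ = (X + _)%N]sum1_card.
  rewrite [LHS]big_mkcond big_split_ord big_ord1 [in RHS]big_mkcond /=.
  congr (_ + _)%N; last by rewrite inE row_mxEr mxE; case: (c == 0).
  by apply: eq_bigr => i _; rewrite !inE row_mxEl.
have := card_zeros_grs_word u_neq0.
have: (size (rVpoly u) <= k)%N by exact: size_poly.
have [c0|_] := eqVneq c 0; last by lia.
rewrite leq_eqVlt => /orP[/eqP sizeu|]; last by lia.
have: lead_coef (rVpoly u) == 0 by rewrite lead_coefE sizeu -/c c0.
by rewrite lead_coef_eq0 => /eqP u0; move: sizeu; rewrite u0 size_poly0; lia.
Qed.

Variable alpha : F.
Hypotheses (alpha_neq0 : alpha != 0) (alpha_norm : alpha ^+ (p ^ e + 1) != 1).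

Lemma grs_hull (l : nat) : (l <= k)%N ->
  exists C : {vspace 'rV[F]_#|A|},
    [/\ \dim C = k, MDS C & \dim (galois_hull p e C) = l].
Proof.
move=> lek; rewrite -[l](subKn lek).
apply: (scaled_mds_hull (S := set0)) alpha_norm _ => //; first exact: grs_mds.
  move=> _ _ /memv_imgP[u1 _ ->] /memv_imgP[u2 _ ->].
  by rewrite !lfunE /= grs_word_self_orthogonal big_set0.
by rewrite cards0 leq_subr.
Qed.

Lemma extended_grs_hull (l : nat) : (l <= k - 1)%N ->
  exists C : {vspace 'rV[F]_(#|A| + 1)},
    [/\ \dim C = k, MDS C & \dim (galois_hull p e C) = l].
Proof.
move=> ltlk; have lek : (l <= k)%N by lia.
rewrite -[l](subKn lek).
(* Infinity already carries a term, so [s = k - l] must be at least 1; this is [l <= k - 1]. *)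
apply: (scaled_mds_hull (S := [set rshift #|A| ord0])) alpha_norm _ => //.
- exact: extended_grs_mds.
- move=> _ _ /memv_imgP[u1 _ ->] /memv_imgP[u2 _ ->].
  rewrite big_set1 !lfunE /= /galois_inner big_split_ord big_ord1 /=.
  rewrite -[RHS]add0r; congr (_ + _).
  rewrite -[RHS](grs_word_self_orthogonal u1 u2).
  by apply: eq_bigr => i _; rewrite !row_mxEl.
by rewrite cards1; lia.
Qed.

End ReedSolomon.

(** * Primitive roots and a divisibility by powers of 2 *)

Lemma finField_prim_root (F : finFieldType) :
  exists g : F, #|F|.-1.-primitive_root g.
Proof.
have q_gt0 : (0 < #|F|.-1)%N by rewrite -subn1 subn_gt0 finNzRing_gt1.
have: has #|F|.-1.-primitive_root (enum [set~ (0 : F)]).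
  apply: has_prim_root; rewrite ?enum_uniq // -?cardE ?cardsC1 //.
  apply/allP => x; rewrite mem_enum !inE unity_rootE => x_neq0.
  apply/eqP/(mulfI x_neq0); rewrite -exprS prednK ?mulr1 ?expf_card //.
  exact: ltnW (finNzRing_gt1 F).
by case/hasP => g _ g_prim; exists g.
Qed.

(** Induction on [t]: a sum of [2 * M] terms is the even number [1 + x ^ M] times the sum of the
    first [M]. *)
Lemma dvdn_geometric_sum (x t s : nat) :
  odd x -> (2 ^ t %| s)%N -> (2 ^ t %| \sum_(i < s) x ^ i)%N.
Proof.
move=> x_odd /dvdnP[c ->]; elim: t c => [|t IHt] c; first exact: dvd1n.
have ->: (c * 2 ^ t.+1 = c * 2 ^ t + c * 2 ^ t)%N by rewrite expnS; lia.
rewrite big_split_ord /=; set M := (c * 2 ^ t)%N.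
under [X in (_ + X)%N]eq_bigr do rewrite expnD.
rewrite -big_distrr /= -[X in (X + _)%N]mul1n -mulnDl expnS dvdn_mul ?IHt //.
by rewrite dvdn2 oddD oddX x_odd orbT.
Qed.

(** * The subfield of order [q0] and cosets of subspaces over it *)

Section Subfield.

Variables (F : finFieldType) (q0 s : nat).
Hypotheses (q0_gt1 : (1 < q0)%N) (q0_char : [pchar F].-nat q0).
Hypothesis cardF : #|F| = (q0 ^ s)%N.

Let K : {set F} := [set x | x ^+ q0 == x].

Lemma subfieldP x : reflect (x ^+ q0 = x) (x \in K).
Proof. by rewrite inE; apply: eqP. Qed.

Lemma subfieldB x y : x \in K -> y \in K -> x - y \in K.
Proof.
move=> /subfieldP xK /subfieldP yK; apply/subfieldP.
by rewrite exprDn_pchar // exprNn_pchar // xK yK.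
Qed.

Lemma subfieldM x y : x \in K -> y \in K -> x * y \in K.
Proof.
by move=> /subfieldP xK /subfieldP yK; apply/subfieldP; rewrite exprMn xK yK.
Qed.

Lemma subfieldV x : x \in K -> x^-1 \in K.
Proof. by move=> /subfieldP xK; apply/subfieldP; rewrite exprVn xK. Qed.

Lemma subfield_expX x j : x \in K -> x ^+ (q0 ^ j) = x.
Proof.
move/subfieldP => xK; elim: j => [|j IHj]; first exact: expr1.
by rewrite expnS exprM xK.
Qed.

(** The index of the multiplicative group of [K] in that of [F]. *)
Let S := (\sum_(i < s) q0 ^ i)%N.

Lemma card_subfield_factor : #|F|.-1 = (q0.-1 * S)%N.
Proof. by rewrite cardF predn_exp. Qed.

Lemma subfield_exp_predn x : x \in K -> x != 0 -> x ^+ q0.-1 = 1.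
Proof.
move=> /subfieldP xK x_neq0; apply: (mulfI x_neq0).
by rewrite -exprS prednK ?xK ?mulr1 // ltnW.
Qed.

Lemma exists_subfield_generator : exists g : F, q0.-1.-primitive_root (g ^+ S).
Proof.
have [g g_prim] := finField_prim_root F; exists g.
have q_gt0 := prim_order_gt0 g_prim.
have := dvdn_prim_root g_prim (_ : q0.-1 %| #|F|.-1)%N.
rewrite {2}card_subfield_factor mulKn; last by lia.
by apply; rewrite card_subfield_factor dvdn_mulr.
Qed.

Lemma card_subfield : #|K| = q0.
Proof.
have [g g_prim] := exists_subfield_generator.
have K0 : 0 \in K by apply/subfieldP; rewrite expr0n gtn_eqF // ltnW.
rewrite (cardsD1 0) K0 add1n -[RHS](prednK (ltnW q0_gt1)); congr _.+1.
rewrite -[RHS]card_ord.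
have <-: [set (g ^+ S) ^+ i | i : 'I_q0.-1] = K :\ 0.
  apply/setP => x; apply/imsetP/setD1P => [[i _ ->]|[x_neq0 xK]].
    split; last first.
      apply/subfieldP; rewrite -[X in _ ^+ X](prednK (ltnW q0_gt1)) exprS.
      by rewrite [X in _ * X]exprAC (prim_expr_order g_prim) expr1n mulr1.
    by rewrite expf_neq0 // (prim_root_eq0 g_prim); lia.
  have [i ->] := prim_rootP g_prim (subfield_exp_predn xK x_neq0).
  by exists i.
rewrite card_imset // => i j /eqP; rewrite (eq_prim_root_expr g_prim).
by rewrite !modn_small // => /eqP/val_inj.
Qed.

(** Nonzero elements of [K] are powers of [g ^+ S], and [d] divides the exponent [S]. *)
Lemma subfield_is_power x (d : nat) :
  (d %| S)%N -> x \in K -> x != 0 -> exists y, y ^+ d = x.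
Proof.
move=> /dvdnP[c Sc] xK x_neq0; have [g g_prim] := exists_subfield_generator.
have [i ->] := prim_rootP g_prim (subfield_exp_predn xK x_neq0).
by exists (g ^+ (c * i)); rewrite Sc -!exprM; congr (_ ^+ _); lia.
Qed.

Definition subfield_submodule (H : {set F}) : Prop :=
  0 \in H /\ forall c x y, c \in K -> x \in H -> y \in H -> c * x + y \in H.

(* The cosets [H + c * b], [c \in W], are distinct when [H] is a [K]-subspace
   not containing [b] and [W] is inside [K]. *)
Definition line_cosets (H W : {set F}) (b : F) : {set F} :=
  [set x.1 + x.2 * b | x in setX H W].

Section Submodule.

Variable H : {set F}.
Hypothesis H_submod : subfield_submodule H.

Lemma submoduleD x y : x \in H -> y \in H -> x + y \in H.
Proof.
move=> xH yH; rewrite -[x]mul1r; apply: H_submod.2 => //.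
by apply/subfieldP; rewrite expr1n.
Qed.

Lemma submoduleM c x : c \in K -> x \in H -> c * x \in H.
Proof. by move=> cK xH; rewrite -[_ * _]addr0 H_submod.2 ?H_submod.1. Qed.

Lemma submoduleN x : x \in H -> - x \in H.
Proof.
move=> xH; rewrite -mulN1r submoduleM //.
by apply/subfieldP; rewrite exprNn_pchar // expr1n.
Qed.

Lemma submoduleB x y : x \in H -> y \in H -> x - y \in H.
Proof. by move=> xH yH; rewrite submoduleD ?submoduleN. Qed.

Variable b : F.
Hypothesis bNH : b \notin H.

(** A collision with [c] different from [c'] puts [(c - c') * b] in [H], and then [b] itself. *)
Lemma line_cosets_inj (W : {set F}) : W \subset K ->
  {in setX H W &, injective (fun x => x.1 + x.2 * b)}.
Proof.
move=> /subsetP WK [x c] [x' c'] /setXP[/= xH cW] /setXP[/= x'H c'W] /eqP.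
rewrite -subr_eq0 => /eqP eq0.
have eqb : (c - c') * b = x' - x.
  by apply/eqP; rewrite -subr_eq0; apply/eqP; rewrite -eq0; ring.
have [cc'|cc'] := eqVneq c c'.
  move: eqb; rewrite cc' subrr mul0r => /esym/eqP.
  by rewrite subr_eq0 => /eqP ->.
case/negP: bNH; rewrite -[b](mulKf (_ : c - c' != 0)) ?subr_eq0 // eqb.
by rewrite submoduleM ?submoduleB ?subfieldV ?subfieldB ?WK.
Qed.

Lemma card_line_cosets (W : {set F}) : W \subset K ->
  #|line_cosets H W b| = (#|H| * #|W|)%N.
Proof.
by move=> WK; rewrite card_in_imset ?cardsX //; apply: line_cosets_inj.
Qed.

Lemma line_cosets_submodule : subfield_submodule (line_cosets H K b).
Proof.
have K0 : 0 \in K by apply/subfieldP; rewrite expr0n gtn_eqF // ltnW.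
split.
  apply/imsetP; exists (0, 0); last by rewrite mul0r addr0.
  by rewrite inE /= H_submod.1 K0.
move=> c _ _ cK /imsetP[[x d] /setXP[/= xH dK] ->]
  /imsetP[[y d'] /setXP[/= yH d'K] ->].
apply/imsetP; exists (c * x + y, c * d + d'); last by rewrite /=; ring.
apply/setXP; split; first exact: H_submod.2.
rewrite -[d']opprK subfieldB ?subfieldM //.
by apply/subfieldP; rewrite exprNn_pchar // (subfieldP _ d'K).
Qed.

End Submodule.

Lemma exists_notin (H : {set F}) j :
  (j < s)%N -> #|H| = (q0 ^ j)%N -> exists b, b \notin H.
Proof.
move=> ltjs cardH; have ltHF : (q0 ^ j < q0 ^ s)%N by rewrite ltn_exp2l.
have: (0 < #|~: H|)%N by have := cardsC H; rewrite cardH cardF; lia.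
by case/card_gt0P => b; rewrite inE; exists b.
Qed.

(** Starting from 0, adjoin the line [K * b] for some [b] outside [H]; each step multiplies the size
    by [q0]. *)
Lemma exists_submodule j : (j <= s)%N ->
  exists2 H : {set F}, subfield_submodule H & #|H| = (q0 ^ j)%N.
Proof.
elim: j => [_|j IHj ltjs].
  exists [set 0]; rewrite ?cards1 //; split; rewrite ?set11 //.
  by move=> c x y _ /set1P-> /set1P->; rewrite mulr0 addr0 set11.
have [H H_submod cardH] := IHj (ltnW ltjs).
have [b bNH] := exists_notin ltjs cardH.
exists (line_cosets H K b); first exact: line_cosets_submodule.
by rewrite card_line_cosets // cardH card_subfield expnSr.
Qed.

(* By homogeneity of [y |-> \prod_(x in H) (y + x)], the factors of the node
   product at [h + c * b] coming from the coset of [c' * b] multiply to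
   [(c - c')] times a constant. *)
Lemma node_prod_line_cosets (H W : {set F}) (b : F) (j : nat) :
    subfield_submodule H -> #|H| = (q0 ^ j)%N -> b \notin H -> W \subset K ->
  exists2 gamma, gamma != 0 & forall a, a \in line_cosets H W b ->
    exists2 c, c \in K /\ c != 0 & node_prod (line_cosets H W b) a = gamma * c.
Proof.
move=> H_submod cardH bNH WK.
pose L y := \prod_(x in H) (y + x).
have L_hom d : d \in K -> d != 0 -> L (d * b) = d * L b.
  (* Scaling by [d] permutes [H], and [d ^+ #|H| = d] since [#|H|] is a power of [q0]. *)
  move=> dK d_neq0; rewrite /L (reindex_inj (mulfI d_neq0)) /=.
  under eq_bigr do rewrite -mulrDr.
  rewrite big_split /= prodr_const.
  have dH x : (d * x \in H) = (x \in H).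
    apply/idP/idP => [dxH|]; last exact: submoduleM.
    by rewrite -[x](mulKf d_neq0) submoduleM ?subfieldV.
  rewrite (eq_card dH) cardH subfield_expX //; congr (_ * _).
  exact: eq_bigl.
have Lb_neq0 : L b != 0.
  apply/prodf_neq0 => x xH; apply: contraNneq bNH => /eqP.
  by rewrite addr_eq0 => /eqP ->; rewrite submoduleN.
pose P := \prod_(x in H :\ 0) x.
have P_neq0 : P != 0 by apply/prodf_neq0 => x; rewrite !inE => /andP[].
(* [P] comes from the coset of the point itself, and each other coset contributes one [L b]. *)
exists (P * L b ^+ #|W|.-1).
  by rewrite mulf_neq0 // expf_neq0.
move=> _ /imsetP[[h c] /setXP[/= hH cW] ->].
exists (node_prod W c).
  split; last exact: node_prod_neq0.
  rewrite /node_prod; elim/big_ind: _ => [|x y|c' /setD1P[_ c'W]].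
  - by apply/subfieldP; rewrite expr1n.
  - exact: subfieldM.
  - by rewrite subfieldB // (subsetP WK).
have hBH x : (h - x \in H) = (x \in H).
  apply/idP/idP => xH; last exact: submoduleB.
  by rewrite -[x](subKr h) submoduleB.
have hB_inj : injective (fun x => h - x).
  by move=> x y /addrI/oppr_inj.
have mulbB c1 c2 : c1 * b - c2 * b = (c1 - c2) * b by rewrite mulrBl.
pose f (x : F * F) := x.1 + x.2 * b.
have f_inj : {in setX H W &, injective f} by exact: line_cosets_inj.
have hcX : (h, c) \in setX H W by apply/setXP.
rewrite /node_prod (_ : line_cosets H W b :\ (h + c * b) =
                       [set f x | x in setX H W :\ (h, c)]); last first.
  apply/setP => a; apply/setD1P/imsetP => [[ahc /imsetP[x xX ax]]|[x]].
    exists x => //; rewrite in_setD1 xX andbT.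
    by apply: contraNneq ahc => xhc; rewrite ax xhc.
  case/setD1P => xhc xX ->; split; last by apply/imsetP; exists x.
  by apply: contraNneq xhc => fx; apply/eqP/f_inj.
rewrite big_imset /=; last first.
  by move=> x y /setD1P[_ xX] /setD1P[_ yX]; exact: f_inj.
transitivity (\prod_(x in H) \prod_(c' in W | (x, c') != (h, c))
    (h - x + (c - c') * b)).
  rewrite pair_big_dep; apply: eq_big => [[x c']|[x c'] _] /=.
    by rewrite !inE /= andbC -andbA.
  by rewrite /f /= opprD addrACA mulrBl.
rewrite (exchange_big_dep (fun c' => c' \in W)) /=; last first.
  by move=> x c' _ /andP[].
rewrite (bigD1 c cW) /= -mulrA; congr (_ * _).
  rewrite (reindex_inj hB_inj) /P /=.
  apply: eq_big => [x|x _]; last by rewrite subrr mul0r addr0 subKr.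
  rewrite !inE hBH cW xpair_eqE eqxx andbT andbC; congr (_ && _).
  by rewrite -subr_eq0 addrAC subrr add0r oppr_eq0.
transitivity (\prod_(c' in W :\ c) ((c - c') * L b)).
  apply: eq_big => [c'|c' /andP[c'W c'c]]; first by rewrite !inE andbC.
  rewrite -L_hom ?subfieldB ?(subsetP WK) ?subr_eq0 1?eq_sym //.
  rewrite (reindex_inj hB_inj); apply: eq_big => [x|x _] /=.
    by rewrite hBH (c'W : c' \in W) xpair_eqE (negPf c'c) andbF andbT.
  by rewrite subKr addrC.
rewrite big_split /= prodr_const mulrC; congr (_ ^+ _ * _).
by rewrite (cardsD1 c W) cW.
Qed.

(* The node products are, up to a common factor, nonzero elements of [K], and
   these are [d]-th powers in [F]. *)
Lemma exists_grs_nodes (j w d : nat) :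
    (j < s)%N -> (w <= q0)%N -> (0 < d)%N -> (d %| S)%N ->
  exists (A : {set F}) (v : F -> F) (gamma : F),
    [/\ #|A| = (w * q0 ^ j)%N, forall a, a \in A -> v a != 0 &
        forall a, a \in A -> v a ^+ d = gamma / node_prod A a].
Proof.
move=> ltjs lew d_gt0 dS.
have [H H_submod cardH] := exists_submodule (ltnW ltjs).
have [b bNH] := exists_notin ltjs cardH.
have [W WK cardW] : exists2 W : {set F}, W \subset K & #|W| = w.
  by apply: exists_subset; rewrite card_subfield.
have [gamma gamma_neq0 nodeE] := node_prod_line_cosets H_submod cardH bNH WK.
(* The membership premise sits under the existential so that finite choice applies to every [a]; off
   the nodes 0 is a dummy value. *)
have exists_v a : exists y, a \in line_cosets H W b ->
    y != 0 /\ y ^+ d = gamma / node_prod (line_cosets H W b) a.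
  have [aA|] := boolP (a \in line_cosets H W b); last by exists 0.
  have [c [cK c_neq0] ->] := nodeE a aA.
  have cV_neq0 : c^-1 != 0 by rewrite invr_eq0.
  have [y yd] := subfield_is_power dS (subfieldV cK) cV_neq0.
  exists y => _; split; last by rewrite yd invfM mulrA divff // mul1r.
  by apply: contraNneq cV_neq0 => y0; rewrite -yd y0 expr0n gtn_eqF.
have [v vP] := fin_all_exists exists_v.
exists (line_cosets H W b), v, gamma; split.
- by rewrite card_line_cosets // cardH cardW mulnC.
- by move=> a /vP[].
- by move=> a /vP[].
Qed.

End Subfield.

(** * The rescaling factor and the numerical conditions *)

Lemma exists_expr_neq1 (F : finFieldType) (d : nat) :
  (0 < d < #|F|.-1)%N -> exists2 alpha : F, alpha != 0 & alpha ^+ d != 1.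
Proof.
case/andP=> d_gt0 ltdF; have [g g_prim] := finField_prim_root F; exists g.
  by rewrite (prim_root_eq0 g_prim); lia.
rewrite -(prim_order_dvd g_prim); apply/negP => /(dvdn_leq d_gt0).
by rewrite leqNgt ltdF.
Qed.

Theorem theorem15 (p m h w z n t e : nat) (F : finFieldType)
    (p_prime : prime p) (p_odd : odd p)
    (m_gt0 : (0 < m)%N) (h_gt0 : (0 < h)%N) (m_dvd_h : (m %| h)%N)
    (cardF : #|F| = (p ^ h)%N)
    (w_bounds : (1 <= w <= p ^ m)%N)
    (z_bounds : (1 <= z <= h %/ m - 1)%N)
    (n_def : n = (w * p ^ (m * z))%N)
    (t_gt0 : (0 < t)%N)
    (e_bound : (e <= h - 1)%N)
    (t_dvd : (2 ^ t %| h %/ m)%N)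
    (t_eq : (2 ^ t = p ^ e + 1)%N) :
  (forall k l : nat,
     (1 <= k <= (p ^ e + n - 1) %/ (p ^ e + 1))%N -> (l <= k)%N ->
     exists C : {vspace 'rV[F]_n},
       [/\ \dim C = k, MDS C & \dim (galois_hull p e C) = l]) /\
  (forall k l : nat,
     (1 <= k <= (p ^ e + n - 1) %/ (p ^ e + 1))%N -> (l <= k - 1)%N ->
     exists C : {vspace 'rV[F]_(n + 1)},
       [/\ \dim C = k, MDS C & \dim (galois_hull p e C) = l]).
Proof.
have p_gt1 := prime_gt1 p_prime.
have h_def : (h = m * (h %/ m))%N by rewrite mulnC divnK.
set s := (h %/ m)%N in h_def z_bounds t_dvd.
have cardF' : #|F| = ((p ^ m) ^ s)%N by rewrite -expnM -h_def.
have q0_gt1 : (1 < p ^ m)%N by rewrite -(exp1n m) ltn_exp2r.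
have q0_char : [pchar F].-nat (p ^ m)%N.
  by rewrite pnatX pnatE // (card_finPcharP cardF).
have d_gt0 : (0 < p ^ e + 1)%N by rewrite addn1.
have d_dvd : (p ^ e + 1 %| \sum_(i < s) (p ^ m) ^ i)%N.
  by rewrite -t_eq dvdn_geometric_sum // oddX p_odd orbT.
have [alpha alpha_neq0 alpha_norm] :
    exists2 alpha : F, alpha != 0 & alpha ^+ (p ^ e + 1) != 1.
  apply: exists_expr_neq1; rewrite d_gt0 cardF.
  (* [p ^ e + 1 = 2 ^ t] divides [s], so it is at most [h], which is less than [p ^ h - 1]. *)
  have les : (p ^ e + 1 <= s)%N by rewrite -t_eq dvdn_leq //; lia.
  have: (p ^ h = p * p ^ h.-1)%N by rewrite -expnS prednK.
  have := ltn_expl h.-1 p_gt1.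
  have p_gt2 : (2 < p)%N by case: (p) p_gt1 p_odd => [|[|[|]]].
  have les_h : (s <= h)%N by rewrite leq_div.
  nia.
have ltzs : (z < s)%N by lia.
have [A [v [gamma [cardA v_neq0 v_norm]]]] :=
  exists_grs_nodes q0_gt1 q0_char cardF' ltzs (proj2 (andP w_bounds))
    d_gt0 d_dvd.
have nE : n = #|A| by rewrite cardA n_def expnM.
(* Subtracting [p ^ e + 1] from both sides of [k * (p ^ e + 1) <= p ^ e + n - 1] leaves [n - 2] on
   the right, the degree bound for orthogonality. *)
have k_bound k : (1 <= k <= (p ^ e + n - 1) %/ (p ^ e + 1))%N ->
    (0 < k)%N /\ (k.-1 * (p ^ e + 1) + 2 <= n)%N.
  case/andP => k_gt0; rewrite leq_divRL // => lek; split=> //.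
  have : (k * (p ^ e + 1) = k.-1 * (p ^ e + 1) + (p ^ e + 1))%N.
    by rewrite -{1}(prednK k_gt0) mulSn addnC.
  lia.
rewrite {}nE in k_bound *.
have p_gt0 := ltnW p_gt1.
split=> k l /k_bound[k_gt0 lek].
  exact: (grs_hull p_gt0 k_gt0 v_neq0 v_norm lek alpha_neq0 alpha_norm).
exact: (extended_grs_hull p_gt0 k_gt0 v_neq0 v_norm lek alpha_neq0 alpha_norm).
Qed.
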